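(* Let $r\ge 2$ be an integer and for $n\ge 2$ let $$\rho_{r,n}(\mathbf{q})=\mathbf{q}^{\binom{r+n-1}{r}+r-1}\,\frac{1-\mathbf{q}^{-r}}{(1-\mathbf{q}^{-1})^2}\in\mathbb{Q}(\mathbf{q}).$$ Then the coefficients $\mathsf{R}_n=\mathsf{R}_n(\mathbf{q})$ satisfy $$\mathsf{R}_0=1,\qquad \mathsf{R}_1=0,\qquad \mathsf{R}_2=\frac{\rho_{r,2}(\mathbf{q})}{2}\,(1-\mathbf{q}^{-r-1}),$$ $$\mathsf{R}_3=\rho_{r,3}(\mathbf{q})\Bigl(1-\mathbf{q}^{-r(r+1)/2}-\mathbf{q}^{-r(r-1)/2}\,\frac{1-2\mathbf{q}^{-r}+2\mathbf{q}^{-2r-1}-\mathbf{q}^{-2r-2}}{3(1-\mathbf{q}^{-1})}\Bigr),$$ $$\mathsf{R}_4=\rho_{r,4}(\mathbf{q})\cdot\Bigl(1+\mathbf{q}^{-\binom{r+1}{3}}\cdot\frac{1+O(\mathbf{q}^{-r(r-1)/2})}{2(1-\mathbf{q}^{-r})}\Bigr),$$ and for $n\ge 5$ $$\mathsf{R}_n=\rho_{r,n}(\mathbf{q})\cdot\Bigl(1+\mathbf{q}^{-\binom{r+n-2}{r-1}+r(r+1)/2}\cdot\frac{1+O(\mathbf{q}^{-r(r-1)/2})}{1-\mathbf{q}^{-r}}\Bigr).$$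
   Context: $\mathbf{q}$ is an indeterminate. For fixed $r\ge2$ and $n\ge 0$ let $\mathsf{P}_n(\mathbf{q})=\mathbf{q}^{\binom{r+n}{r}-1}\frac{1-\mathbf{q}^{-\binom{r-1+n}{r-1}}}{1-\mathbf{q}^{-1}}\in\mathbb{Z}[\mathbf{q}]$ (so $\mathsf{P}_0=1$), and define power series in $\mathbb{Q}(\mathbf{q})[[z]]$ by $\mathsf{P}(\mathbf{q},z)=\sum_{n\ge0}\mathsf{P}_n(\mathbf{q})z^n$, $\mathsf{I}(\mathbf{q},z)=\sum_{k\ge1}\frac{\mu(k)}{k}\log\mathsf{P}(\mathbf{q},z^k)$ and $\mathsf{R}(\mathbf{q},z)=\mathsf{P}(\mathbf{q},z)-\mathsf{I}(\mathbf{q},z)$, where $\mu$ is the Möbius function and $\log(1-f)=-\sum_{i\ge1}f^i/i$ for a power series $f$ with zero constant term. $\mathsf{R}_n(\mathbf{q})$ is the coefficient of $z^n$ in $\mathsf{R}(\mathbf{q},z)$. For nonzero $f\in\mathbb{Q}(\mathbf{q})$, $\deg_{\mathbf{q}}f$ is the numerator degree minus the denominator degree. For a positive integer $m$ and fixed $r,n$, $O(\mathbf{q}^{-m})$ in an equation stands for some $f\in\mathbb{Q}(\mathbf{q})$ of degree at most $-m$ (possibly zero) that makes the equation valid. *)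

(* Defs.v *)
From HB Require Import structures.
From mathcomp Require Import all_boot all_order all_algebra generic_quotient.

Set Implicit Arguments.
Unset Strict Implicit.
Unset Printing Implicit Defensive.

Import Order.TTheory GRing.Theory Num.Theory.
Local Open Scope ring_scope.

Definition moebius (k : nat) : int :=
  if all (fun p => logn p k == 1%N) (primes k)
  then (-1) ^+ size (primes k) else 0.

(* F : fps K is the formal power series whose coefficient of z^n is F n. *)
Definition fps (K : fieldType) := nat -> K.

Section PowerSeries.
Variable K : fieldType.
Implicit Types (F G : fps K) (a : nat -> fps K).

Definition fps_one : fps K := fun n => (n == 0%N)%:R.

Definition fps_sub F G : fps K := fun n => F n - G n.

Definition fps_mul F G : fps K := fun n => \sum_(i < n.+1) F i * G (n - i)%N.

Definition fps_pow F i : fps K := iter i (fps_mul F) fps_one.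

Definition fps_scale (c : K) F : fps K := fun n => c * F n.

(* The series F(z^k), for k > 0. *)
Definition fps_subst_pow F k : fps K :=
  fun n => if (k %| n)%N then F (n %/ k)%N else 0.

(* The infinite sum of the series a i over i >= 1, for families such that
   a i has z-adic order at least i: only the a i with i <= n contribute to the
   coefficient of z^n. Both families summed below have this property; see
   fps_log_summable and Iser_summable. *)
Definition fps_sum a : fps K := fun n => \sum_(1 <= i < n.+1) a i n.

(* log F = - sum_{i >= 1} (1 - F)^i / i, for F with constant term 1. *)
Definition fps_log_term F i : fps K :=
  fps_scale (- i%:R^-1) (fps_pow (fps_sub fps_one F) i).

Definition fps_log F : fps K := fps_sum (fps_log_term F).

Lemma fps_pow_lt F i n : F 0%N = 0 -> (n < i)%N -> fps_pow F i n = 0.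
Proof.
move=> F0; elim: i n => [//|i IH] n ltni.
rewrite /fps_pow /= -/(fps_pow F i) /fps_mul big1 // => j _.
have [->|j_gt0] := posnP j; first by rewrite F0 mul0r.
rewrite IH ?mulr0 //; case: n j ltni j_gt0 => [|n] j ltni j_gt0.
  by case: j j_gt0 => [[]].
apply: leq_ltn_trans (_ : n < i)%N => //.
by rewrite leq_subLR (leq_add2r n 1).
Qed.

Lemma fps_log_summable F i n :
  F 0%N = 1 -> (n < i)%N -> fps_log_term F i n = 0.
Proof.
move=> F0 ltni; rewrite /fps_log_term /fps_scale fps_pow_lt ?mulr0 //.
by rewrite /fps_sub /fps_one F0 eqxx subrr.
Qed.

End PowerSeries.

(* The field Q(q). *)
Notation Qq := {fraction {poly rat}}.

Local Notation "x %:F" := (@FracField.tofrac _ x).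

Definition qX : Qq := ('X : {poly rat})%:F.

Definition deg_q (f : Qq) : int :=
  (size \n_(repr f))%:Z - (size \d_(repr f))%:Z.

Lemma frac_repr (R : idomainType) (f : {fraction R}) :
  f = (\n_(repr f))%:F / (\d_(repr f))%:F.
Proof.
have d0 := denom_ratioP (repr f).
apply: canRL (mulfK _) _; first by rewrite tofrac_eq0.
rewrite -{1}[f]reprK; unlock FracField.tofrac.
rewrite -[LHS]FracField.pi_mul.
apply/eqmodP; rewrite /= FracField.equivfE /FracField.mulf.
by rewrite !numden_Ratio ?mulr1 ?oner_neq0 // mulrC.
Qed.

Lemma frac_cross (R : idomainType) (a b : R) (f : {fraction R}) :
  b != 0 -> f = a%:F / b%:F -> a * \d_(repr f) = \n_(repr f) * b.
Proof.
move=> b0 Ef; have d0 := denom_ratioP (repr f).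
apply/eqP; rewrite -tofrac_eq !tofracM -eqr_div ?tofrac_eq0 //.
by rewrite -frac_repr Ef.
Qed.

(* repr picks one representation of f as a quotient; the degree does not depend
   on this choice. *)
Lemma deg_qE (a b : {poly rat}) : a != 0 -> b != 0 ->
  deg_q (a%:F / b%:F) = (size a)%:Z - (size b)%:Z.
Proof.
move=> a0 b0; rewrite /deg_q; set f := a%:F / b%:F.
set c := \n_(repr f); set d := \d_(repr f).
have d0 : d != 0 by apply: denom_ratioP.
have cross : a * d = c * b by apply: frac_cross.
have c0 : c != 0.
  apply: contraNneq a0 => c0.
  by move/eqP: cross; rewrite c0 mul0r mulf_eq0 (negPf d0) orbF.
have := congr1 (fun p : {poly rat} => size p) cross.
rewrite /= !size_mul //.
move: a0 b0 c0 d0; rewrite -!size_poly_gt0.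
case: (size a) (size b) (size c) (size d) => [//|sa] [//|sb] [//|sc] [//|sd].
move=> _ _ _ _; rewrite !addSn !addnS /= => -[E].
apply/eqP; rewrite subr_eq addrAC eq_sym subr_eq -!PoszD eqz_nat.
by rewrite !addSn !addnS E.
Qed.

(* f is an admissible value of O(q^-m). *)
Definition isO_q (m : nat) (f : Qq) : Prop := f = 0 \/ deg_q f <= - m%:Z.

Definition Pser (r : nat) : fps Qq := fun n =>
  qX ^+ ('C(r + n, r) - 1)%N
    * ((1 - qX ^ (- ('C(r - 1 + n, r - 1)%N)%:Z)) / (1 - qX ^ (- 1))).

Definition Iser_term (r k : nat) : fps Qq :=
  fps_scale ((moebius k)%:~R / k%:R) (fps_log (fps_subst_pow (Pser r) k)).

Definition Iser (r : nat) : fps Qq := fps_sum (Iser_term r).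

Definition Rser (r : nat) : fps Qq := fps_sub (Pser r) (Iser r).

Definition rho (r n : nat) : Qq :=
  qX ^+ ('C(r + n - 1, r) + r - 1)%N
    * ((1 - qX ^ (- r%:Z)) / (1 - qX ^ (- 1)) ^+ 2).

Lemma qX_neq1 : 1 - qX ^ (- 1) != 0.
Proof.
rewrite subr_eq0 eq_sym -exprz_inv expr1z invr_eq1 /qX -tofrac1 tofrac_eq.
by apply/eqP => /(congr1 (fun p : {poly rat} => size p)); rewrite size_polyX size_poly1.
Qed.

Lemma Pser0 r : Pser r 0%N = 1.
Proof. by rewrite /Pser !addn0 !binn subnn expr0 mul1r divff // qX_neq1. Qed.

Lemma Iser_summable r k n : (n < k)%N -> Iser_term r k n = 0.
Proof.
move=> ltnk; rewrite /Iser_term /fps_scale /fps_log /fps_sum.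
rewrite big1_seq ?mulr0 // => i; rewrite mem_index_iota => /andP[_ /andP[i_gt0 _]].
rewrite /fps_log_term /fps_scale.
set G := fps_sub _ _; suff ->: fps_pow G i n = 0 by rewrite mulr0.
have G0 m : (m < k)%N -> G m = 0.
  move=> ltmk; rewrite /G /fps_sub /fps_one /fps_subst_pow.
  have [->|m_gt0] := posnP m; first by rewrite dvdn0 div0n Pser0 subrr.
  by rewrite (gtnNdvd m_gt0 ltmk) subr0.
case: i i_gt0 => // i _; rewrite /fps_pow /= /fps_mul big1 // => j _.
by rewrite G0 ?mul0r //; apply: leq_ltn_trans ltnk; rewrite -ltnS.
Qed.

(* Main.v *)
(** Write d_n = binom(r+n, r) - 1 and u = 1/(1 - q^-1), so that
P_n = u (q^(d_n) - q^(d_(n-1))) has degree d_n. The increments of d are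
nondecreasing, so d is convex; hence the coefficient of z^n in (P - 1)^i has
degree at most (i-1) r + d_(n-i+1), and the terms with k >= 2 in I contribute
degree at most d_(n/2) to R_n. Up to an error of degree at most 2r + d_(n-2),
R_n is therefore the half of sum_j P_j P_(n-j), and then
P_1 P_(n-1) + P_2 P_(n-2) for n >= 5 (with the second product halved for
n = 4). The first product is rho_(r,n) up to a small error, the second is
u^2 q^(d_2 + d_(n-2)) (1 + O(q^(-r(r-1)/2))), and the error bound above is
exactly d_2 + d_(n-2) - r(r-1)/2. For n <= 3 the logarithms are expanded
explicitly. *)
Require Import Defs.
From mathcomp Require Import all_boot all_order all_algebra.
From mathcomp Require Import ring zify.

Import Order.TTheory GRing.Theory Num.Theory.
Local Open Scope ring_scope.

Local Notation "x %:F" := (@FracField.tofrac _ x).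

(** * Degree bounds for rational functions in q *)

(* The fractions of degree at most 0 form a subring. *)
Definition proper_frac (f : Qq) : Prop :=
  exists a b : {poly rat}, [/\ b != 0, (size a <= size b)%N & f = a%:F / b%:F].

Lemma leq_size_polyM (a b c d : {poly rat}) : b != 0 -> d != 0 ->
  (size a <= size b)%N -> (size c <= size d)%N -> (size (a * c)%R <= size (b * d)%R)%N.
Proof.
move=> b0 d0 sab scd; rewrite (size_mul b0 d0) (leq_trans (size_polyMleq _ _)) //.
by rewrite -!subn1 leq_sub2r // leq_add.
Qed.

Lemma proper_fracD f g : proper_frac f -> proper_frac g -> proper_frac (f + g).
Proof.
move=> [a [b [b0 sab ->]]] [c [d [d0 scd ->]]].
exists (a * d + c * b), (b * d); split; first by rewrite mulf_neq0.
- apply: (leq_trans (size_polyD _ _)); rewrite geq_max.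
  by rewrite leq_size_polyM //= (mulrC c) leq_size_polyM.
- by rewrite addf_div ?tofrac_eq0 // !tofracD !tofracM.
Qed.

Lemma proper_fracM f g : proper_frac f -> proper_frac g -> proper_frac (f * g).
Proof.
move=> [a [b [b0 sab ->]]] [c [d [d0 scd ->]]].
exists (a * c), (b * d); split; first by rewrite mulf_neq0.
- exact: leq_size_polyM.
- by rewrite mulf_div !tofracM.
Qed.

Lemma proper_frac0 : proper_frac 0.
Proof. by exists 0, 1; rewrite oner_neq0 size_poly0 tofrac0 mul0r. Qed.

Lemma proper_frac_nat n : proper_frac n%:R.
Proof.
exists n%:R, 1; rewrite oner_neq0 tofrac1 divr1 rmorph_nat; split=> //.
by rewrite -polyC_natr size_poly1 size_polyC_leq1.
Qed.

Lemma proper_frac_natV n : proper_frac n%:R^-1.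
Proof.
have [->|n0] := posnP n; first by rewrite invr0; exact: proper_frac0.
have n0' : n%:R != 0 :> {poly rat}.
  by rewrite -polyC_natr polyC_eq0 pnatr_eq0 -lt0n.
exists 1, n%:R; split=> //; first by rewrite size_poly1 size_poly_gt0.
by rewrite tofrac1 mul1r rmorph_nat.
Qed.

Lemma proper_fracN f : proper_frac f -> proper_frac (- f).
Proof.
move=> [a [b [b0 sab ->]]]; exists (- a), b; split=> //; first by rewrite size_polyN.
by rewrite tofracN mulNr.
Qed.

Lemma proper_frac_int (k : int) : proper_frac k%:~R.
Proof.
case: k => n; first exact: proper_frac_nat.
by rewrite NegzE mulrNz; apply/proper_fracN/proper_frac_nat.
Qed.

Lemma qX_neq0 : qX != 0.
Proof. by rewrite tofrac_eq0 polyX_eq0. Qed.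

Lemma qX_expr_neq0 m : qX ^+ m != 0.
Proof. exact: expf_neq0 m qX_neq0. Qed.

Lemma proper_frac_qXV m : proper_frac (qX ^+ m)^-1.
Proof.
exists 1, ('X^m); rewrite -size_poly_gt0 size_polyXn size_poly1; split=> //.
by rewrite tofrac1 mul1r tofracXn.
Qed.

(** Clearing the negative power gives q / (q - 1), whose numerator and denominator have equal
    degree. *)
Lemma proper_frac_geo : proper_frac (1 - qX ^ (-1))^-1.
Proof.
have s : size ('X - 1 : {poly rat}) = 2 by rewrite -polyC1 size_XsubC.
exists 'X, ('X - 1); split; first by rewrite -size_poly_gt0 s.
  by rewrite s size_polyX.
have q1 : qX - 1 != 0.
  by rewrite /qX -tofrac1 -tofracB tofrac_eq0 -size_poly_gt0 s.
rewrite tofracB tofrac1 -/qX exprN1.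
have -> : 1 - qX^-1 = (qX - 1) / qX by rewrite mulrBl divff ?qX_neq0 // mul1r.
by rewrite invf_div.
Qed.

(** Passes from proper fractions to the O-notation; a zero numerator falls under the first
    alternative of [isO_q]. *)
Lemma isO_q_proper m f : proper_frac f -> isO_q m (f / qX ^+ m).
Proof.
move=> [a [b [b0 sab ->]]]; rewrite /isO_q.
have [->|a0] := eqVneq a 0; first by left; rewrite tofrac0 !mul0r.
have X0 : 'X^m != 0 :> {poly rat} by rewrite -size_poly_gt0 size_polyXn.
right; rewrite /qX -tofracXn -mulrA -invfM -tofracM deg_qE ?mulf_neq0 //.
have -> : size (b * 'X^m) = (size b + m)%N by rewrite size_mulXn // addnC.
lia.
Qed.

(** Zero satisfies every such bound, so sums and products need no case distinction, in contrast to
    bounds on [deg_q]. *)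
Definition deg_le (m : nat) (f : Qq) : Prop := exists2 g, proper_frac g & f = qX ^+ m * g.

Lemma deg_le0 m : deg_le m 0.
Proof. by exists 0; [exact: proper_frac0 | rewrite mulr0]. Qed.

Lemma deg_leD m f g : deg_le m f -> deg_le m g -> deg_le m (f + g).
Proof.
by move=> [a pa ->] [b pb ->]; exists (a + b); [exact: proper_fracD | rewrite mulrDr].
Qed.

Lemma deg_leN m f : deg_le m f -> deg_le m (- f).
Proof. by move=> [a pa ->]; exists (- a); [exact: proper_fracN | rewrite mulrN]. Qed.

Lemma deg_leM m n f g : deg_le m f -> deg_le n g -> deg_le (m + n) (f * g).
Proof.
move=> [a pa ->] [b pb ->]; exists (a * b); first exact: proper_fracM.
by rewrite exprD mulrACA.
Qed.

Lemma deg_leZ m c f : proper_frac c -> deg_le m f -> deg_le m (c * f).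
Proof.
by move=> pc [a pa ->]; exists (c * a); [exact: proper_fracM | rewrite mulrCA].
Qed.

Lemma deg_le_sum m (I : Type) (s : seq I) (P : pred I) F :
  (forall i, P i -> deg_le m (F i)) -> deg_le m (\sum_(i <- s | P i) F i).
Proof.
by move=> H; apply: big_ind => //; [exact: deg_le0 | move=> *; exact: deg_leD].
Qed.

Lemma deg_le_leq m n f : (m <= n)%N -> deg_le m f -> deg_le n f.
Proof.
move=> lemn [a pa ->]; exists ((qX ^+ (n - m))^-1 * a).
  exact/proper_fracM/pa/proper_frac_qXV.
by rewrite -{1}(subnKC lemn) exprD mulrA mulfK ?qX_expr_neq0.
Qed.

Lemma deg_le_qX m : deg_le m (qX ^+ m).
Proof. by exists 1; [exact: (proper_frac_nat 1) | rewrite mulr1]. Qed.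

Lemma natq_neq0 n : n.+1%:R != 0 :> Qq.
Proof.
rewrite -[n.+1%:R](rmorph_nat (@FracField.tofrac _)) tofrac_eq0.
by rewrite -polyC_natr polyC_eq0 pnatr_eq0.
Qed.

(** * First coefficients of the logarithm of a power series *)

Section Log.
Variable K : fieldType.
Implicit Types F G : fps K.

Lemma fps_mul1 F n : fps_mul F (fps_one K) n = F n.
Proof.
rewrite /fps_mul big_ord_recr /= subnn mulr1 big1 ?add0r // => i _.
by rewrite /fps_one subn_eq0 leqNgt ltn_ord mulr0.
Qed.

Lemma fps_pow1 G n : fps_pow G 1 n = G n.
Proof. exact: fps_mul1. Qed.

Lemma fps_powS G i n :
  fps_pow G i.+1 n = \sum_(j < n.+1) G j * fps_pow G i (n - j)%N.
Proof. by []. Qed.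

Lemma fps_pow2 G n : fps_pow G 2 n = \sum_(j < n.+1) G j * G (n - j)%N.
Proof. by rewrite fps_powS; apply: eq_bigr => j _; rewrite fps_pow1. Qed.

Lemma fps_log1 F : F 0%N = 1 -> fps_log F 1%N = F 1%N.
Proof.
move=> F0; rewrite /fps_log /fps_sum big_nat1 /fps_log_term /fps_scale fps_pow1.
by rewrite /fps_sub /fps_one /= invr1 sub0r mulN1r opprK.
Qed.

Lemma fps_log2 F : F 0%N = 1 -> fps_log F 2%N = F 2%N - F 1%N ^+ 2 / 2%:R.
Proof.
move=> F0; rewrite /fps_log /fps_sum unlock /= /fps_log_term /fps_scale.
rewrite fps_pow1 fps_pow2 !big_ord_recl big_ord0 /= /fps_sub /fps_one /= F0.
rewrite invr1; ring.
Qed.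

(** The square of 1 - F contributes F_1 F_2 twice, divided by 2, and its cube contributes -F_1^3. *)
Lemma fps_log3 F : (2%:R : K) != 0 -> (3%:R : K) != 0 -> F 0%N = 1 ->
  fps_log F 3%N = F 3%N - F 1%N * F 2%N + F 1%N ^+ 3 / 3%:R.
Proof.
move=> n2 n3 F0; rewrite /fps_log /fps_sum unlock /= /fps_log_term /fps_scale.
rewrite fps_pow1 fps_pow2 (fps_powS _ 2).
under [X in _ * X + 0]eq_bigr do rewrite fps_pow2.
rewrite !big_ord_recl !big_ord0 /= /fps_sub /fps_one /bump /= F0 invr1.
by field; rewrite n2 n3.
Qed.
End Log.

(** * The exponents d_n, their increments and their convexity *)

(** The exponent d_n, which is the degree of P_n in q. *)
Definition pdeg (r n : nat) : nat := ('C(r + n, r) - 1)%N.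

(** The increment d_(n+1) - d_n, by Pascal's rule. *)
Definition pinc (r n : nat) : nat := 'C(r + n, r - 1).

Lemma pdegS r n : (0 < r)%N -> pdeg r n.+1 = (pdeg r n + pinc r n)%N.
Proof.
case: r => // r _; rewrite /pdeg /pinc addnS binS (_ : r.+1 - 1 = r)%N; last by lia.
have : (0 < 'C(r.+1 + n, r.+1))%N by rewrite bin_gt0 leq_addr.
lia.
Qed.

Lemma pinc_mono r : {homo pinc r : m n / (m <= n)%N}.
Proof. by move=> m n lemn; apply: leq_bin2l; rewrite leq_add2l. Qed.

Section Pdeg.
Variables (r : nat) (hr : (2 <= r)%N).

Let r_gt0 : (0 < r)%N. Proof. exact: ltnW. Qed.

Lemma pdeg0 : pdeg r 0 = 0%N.
Proof. by rewrite /pdeg addn0 binn. Qed.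

Lemma pinc0 : pinc r 0 = r.
Proof. by rewrite /pinc addn0 subn1 -[X in 'C(X, _)](prednK r_gt0) binSn prednK. Qed.

Lemma pdeg1 : pdeg r 1 = r.
Proof. by rewrite pdegS // pdeg0 pinc0. Qed.

Lemma pinc1 : pinc r 1 = (r * (r + 1) %/ 2)%N.
Proof.
rewrite /pinc addn1 -bin_sub; last by lia.
by rewrite (_ : r.+1 - (r - 1) = 2)%N ?bin2 -?divn2 1?mulnC ?addn1 //; lia.
Qed.

(** Turns the exponent -binom(r+n-2, r-1) + r(r+1)/2 at n = 4 into -binom(r+1, 3). *)
Lemma pinc2 : pinc r 2 = ('C(r + 1, 3) + r * (r + 1) %/ 2)%N.
Proof.
rewrite /pinc -bin_sub; last by lia.
rewrite (_ : r + 2 - (r - 1) = 3)%N; last by lia.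
by rewrite addn2 binS bin2 -divn2 addn1 mulnC.
Qed.

(** Together with [pdeg2] this gives d_2 = r(r-1)/2 + 2r, which links the error bound 2r + d_(n-2)
    to the relative error q^(-r(r-1)/2). *)
Lemma triangle_step : (r * (r + 1) %/ 2 = r * (r - 1) %/ 2 + r)%N.
Proof.
have -> : (r * (r + 1) = r * 2 + r * (r - 1))%N by nia.
by rewrite divnMDl // addnC.
Qed.

Lemma pdeg2 : pdeg r 2 = (r * (r + 1) %/ 2 + r)%N.
Proof. by rewrite pdegS // pdeg1 pinc1 addnC. Qed.

Lemma pdeg_mono : {homo pdeg r : m n / (m <= n)%N}.
Proof. by apply: homo_leq => // [m n p|m]; [exact: leq_trans | rewrite pdegS // leq_addr]. Qed.

(** Each unit step adds an increment at a + i on the left and the larger increment at b + i on the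
    right. *)
Lemma pdeg_convex i a b : (a <= b)%N ->
  (pdeg r (a + i) + pdeg r b <= pdeg r a + pdeg r (b + i))%N.
Proof.
move=> leab; elim: i => [|i IH]; first by rewrite !addn0.
have := @pinc_mono r (a + i)%N (b + i)%N; rewrite leq_add2r => /(_ leab).
rewrite !addnS !pdegS //; lia.
Qed.

Lemma pdeg_superadd a b : (pdeg r a + pdeg r b <= pdeg r (a + b))%N.
Proof. by have := @pdeg_convex a 0 b (leq0n b); rewrite pdeg0 add0n addnC (addnC b). Qed.

Lemma pdeg_addM i m : (i * r + pdeg r m <= pdeg r (i + m))%N.
Proof.
elim: i => [|i IH]; first by rewrite mul0n.
by have := pdeg_superadd 1 (i + m)%N; rewrite pdeg1 mulSn add1n addSn; lia.
Qed.

(** Induction on r, with equality at r = 2. Passing from r to r + 1 adds binom(r+3, 2) on the left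
    and 2 + binom(r+3, 3) on the right, and 3 binom(r+3, 3) = (r+1) binom(r+3, 2). This absorbs the
    products P_j P_(n-j) with 3 <= j <= n - 3 into the error. *)
Lemma pdeg3 : (pdeg r 3 <= 2 * r + pinc r 3)%N.
Proof.
have -> : pdeg r 3 = ('C(r.+3, 3) - 1)%N by rewrite /pdeg -[in LHS]bin_sub ?leq_addr // addKn addn3.
have -> : pinc r 3 = 'C(r.+3, 4).
  by rewrite /pinc -bin_sub; [congr 'C(_, _) | ]; lia.
elim: r hr => // n IH; rewrite leq_eqVlt => /predU1P[<- //|lt2n]; have {}IH := IH lt2n.
have := mul_bin_left n.+3 2; rewrite (_ : n.+3 - 2 = n.+1)%N; last by lia.
move=> E; rewrite (binS n.+3 3) (binS n.+3 2).
have : ('C(n.+3, 2) <= 'C(n.+3, 3))%N.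
  by rewrite -(leq_pmul2l (isT : 0 < 3)%N) E leq_mul2r lt2n orbT.
lia.
Qed.
End Pdeg.

(** * Degree bounds for powers, logarithms and the coefficients of R *)

Lemma fps_subst_pow1 (K : fieldType) (F : fps K) n : fps_subst_pow F 1 n = F n.
Proof. by rewrite /fps_subst_pow dvd1n divn1. Qed.

Section Bounds.
Variables (r : nat) (hr : (2 <= r)%N).

Let r_gt0 : (0 < r)%N. Proof. exact: ltnW. Qed.

Lemma PserS n : Pser r n.+1 =
  (1 - qX ^ (- 1))^-1 * (qX ^+ pdeg r n.+1 - qX ^+ pdeg r n).
Proof.
rewrite /Pser -/(pdeg r n.+1) (_ : r - 1 + n.+1 = r + n)%N; last by lia.
rewrite -/(pinc r n) mulrA mulrC; congr (_ * _).
rewrite mulrBr mulr1 pdegS // exprD -exprnN mulfK //.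
exact: qX_expr_neq0.
Qed.

Lemma deg_le_Pser n : deg_le (pdeg r n) (Pser r n).
Proof.
case: n => [|n]; first by rewrite Pser0 pdeg0; exact: (deg_le_qX 0).
rewrite PserS; apply: deg_leZ proper_frac_geo _.
apply: deg_leD (deg_le_qX _) (deg_leN _ _ _).
by apply: deg_le_leq (deg_le_qX _); apply: pdeg_mono.
Qed.

(** A nonzero product G_j (G^(i+1))_(n-j) has j >= 1 and n - j > i. Its degree is at most d_j + i r
    + d_(n-j-i), and convexity, shifting j - 1 units, bounds d_j + d_(n-j-i) by r + d_(n-i-1). *)
Lemma deg_le_fps_pow (G : fps Qq) i n : G 0%N = 0 ->
    (forall m, deg_le (pdeg r m) (G m)) ->
  deg_le (i * r + pdeg r (n - i)) (fps_pow G i.+1 n).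
Proof.
move=> G0 dG; elim: i n => [|i IH] n.
  by rewrite fps_pow1 mul0n add0n subn0.
rewrite fps_powS; apply: deg_le_sum => j _.
have [->|j_gt0] := posnP j; first by rewrite G0 mul0r; exact: deg_le0.
have [le_nj_i|lt_i_nj] := leqP (n - j) i.
  by rewrite fps_pow_lt ?mulr0 ?ltnS //; exact: deg_le0.
apply: deg_le_leq (deg_leM _ _ _ _ (dG _) (IH _)).
have := @pdeg_convex r hr j.-1 1 (n - j - i); rewrite pdeg1 //.
rewrite (_ : 1 + j.-1 = j)%N; last by lia.
rewrite (_ : n - j - i + j.-1 = n - i.+1)%N; last by lia.
rewrite subn_gt0 mulSn => /(_ lt_i_nj); lia.
Qed.

(** Superadditivity of d and floor(j/2) + floor((n-j)/2) <= floor(n/2). The hypothesis is met by 1 -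
    P(q, z^k) for k >= 2. *)
Lemma deg_le_fps_pow_half (G : fps Qq) i n :
    (forall m, deg_le (pdeg r (m %/ 2)) (G m)) ->
  deg_le (pdeg r (n %/ 2)) (fps_pow G i n).
Proof.
move=> dG; elim: i n => [|i IH] n.
  apply: (deg_le_leq 0) => //; rewrite /fps_pow /= /fps_one.
  by exists (n == 0%N)%:R; [exact: proper_frac_nat | rewrite mul1r].
rewrite fps_powS; apply: deg_le_sum => j _.
apply: deg_le_leq (deg_leM _ _ _ _ (dG _) (IH _)).
apply: (leq_trans (pdeg_superadd r hr _ _)); apply: (pdeg_mono r hr).
have := ltn_ord j; lia.
Qed.

Lemma deg_le_fps_sub1 (F : fps Qq) m n :
  deg_le m (F n) -> deg_le m (fps_sub (fps_one Qq) F n).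
Proof.
move=> dF; apply: deg_leD (deg_leN _ _ dF); apply: (deg_le_leq 0) => //.
by exists (n == 0%N)%:R; [exact: proper_frac_nat | rewrite mul1r].
Qed.

Lemma deg_le_Iser_term k n : (2 <= k)%N ->
  deg_le (pdeg r (n %/ 2)) (Iser_term r k n).
Proof.
move=> k2; rewrite /Iser_term /fps_scale; apply: deg_leZ.
  exact/proper_fracM/proper_frac_natV/proper_frac_int.
rewrite /fps_log /fps_sum; apply: deg_le_sum => i _.
rewrite /fps_log_term /fps_scale; apply: deg_leZ; first exact/proper_fracN/proper_frac_natV.
apply: deg_le_fps_pow_half => m; apply: deg_le_fps_sub1.
rewrite /fps_subst_pow; case: ifP => _; last exact: deg_le0.
by apply: deg_le_leq (deg_le_Pser _); apply: pdeg_mono => //; apply: leq_div2l.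
Qed.

(** In the k = 1 part of I the linear term of the logarithm cancels P_n and the quadratic term gives
    the half sum; what remains is [L], the higher powers, and [I], the terms with k >= 2. *)
Lemma deg_le_Rser n : (3 <= n)%N ->
  deg_le (2 * r + pdeg r (n - 2))
    (Rser r n - 2%:R^-1 * \sum_(1 <= j < n) Pser r j * Pser r (n - j)%N).
Proof.
move=> n3; set S := \sum_(1 <= j < n) _.
set G := fps_sub (fps_one Qq) (fps_subst_pow (Pser r) 1).
have GE m : G m = (m == 0%N)%:R - Pser r m by rewrite /G /fps_sub fps_subst_pow1.
have G0 : G 0%N = 0 by rewrite GE Pser0 subrr.
have dG m : deg_le (pdeg r m) (G m).
  by apply: deg_le_fps_sub1; rewrite fps_subst_pow1; apply: deg_le_Pser.
have G2 : fps_pow G 2 n = S.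
  rewrite fps_pow2 -(big_mkord xpredT (fun j => G j * G (n - j)%N)).
  rewrite big_ltn // G0 mul0r add0r big_nat_recr /=; last by lia.
  rewrite subnn G0 mulr0 addr0 /S; apply: eq_big_nat => j /andP[j1 jn].
  by rewrite !GE !gtn_eqF ?subn_gt0 // !sub0r mulrNN.
have lt1n : (1 < n.+1)%N by lia.
have lt2n : (2 < n.+1)%N by lia.
rewrite /Rser /fps_sub /Iser /fps_sum big_ltn // {1}/Iser_term /fps_scale.
rewrite /moebius /= divr1 mul1r /fps_log /fps_sum -/G.
set I := \sum_(2 <= k < _) _.
rewrite (big_ltn lt1n) (big_ltn lt2n).
rewrite {1 2}/fps_log_term /fps_scale -/G fps_pow1 G2 GE gtn_eqF; last by lia.
rewrite invr1; set L := \sum_(3 <= i < _) _.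
have -> : Pser r n - (- (1) * (0 - Pser r n) + (- 2%:R^-1 * S + L) + I) - 2%:R^-1 * S
   = - L - I by ring.
apply: deg_leD; apply: deg_leN; rewrite /L /I big_seq; apply: deg_le_sum => i.
  rewrite mem_index_iota => /andP[i3 iltn].
  case: i i3 iltn => [|i] // i3 iltn.
  rewrite /fps_log_term /fps_scale -/G; apply: deg_leZ.
    exact/proper_fracN/proper_frac_natV.
  apply: deg_le_leq (deg_le_fps_pow _ _ _ G0 dG).
  (* The power is now i + 1, with bound i r + d_(n-i); superadditivity absorbs i - 2 of the summands
     r into d_(n-2). *)
  have := pdeg_addM r hr (i - 2) (n - i).
  rewrite (_ : i - 2 + (n - i) = n - 2)%N; last by lia.
  nia.
rewrite mem_index_iota => /andP[i2 _].
apply: deg_le_leq (deg_le_Iser_term _ _ i2).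
(* Here n >= 3 gives floor(n/2) <= n - 2. *)
by apply: leq_trans (leq_addl _ _); apply: pdeg_mono => //; lia.
Qed.

Lemma deg_le_Rser_main n : (4 <= n)%N ->
  deg_le (2 * r + pdeg r (n - 2))
    (Rser r n - (Pser r 1 * Pser r (n - 1)%N
                 + (if n == 4%N then 2%:R^-1 else 1) * (Pser r 2 * Pser r (n - 2)%N))).
Proof.
have n2 := natq_neq0 1.
move=> n4; have := @deg_le_Rser n (ltnW n4).
have [->|n_neq4] := eqVneq n 4%N.
  (* The sum is 2 P_1 P_3 + P_2^2: the middle term is its own mirror image and keeps the factor
     1/2. *)
  rewrite big_ltn // big_ltn // big_nat1.
  by congr deg_le; field.
have n5 : (5 <= n)%N by lia.
set M := \sum_(1 <= j < n) _.
have EM : M = 2%:R * (Pser r 1 * Pser r (n - 1)%N + Pser r 2 * Pser r (n - 2)%N)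
    + \sum_(3 <= j < n - 2) Pser r j * Pser r (n - j)%N.
  rewrite /M big_ltn; last by lia.
  rewrite big_ltn; last by lia.
  case: n n4 n_neq4 n5 M => [|[|n]] // n4 n_neq4 n5 M.
  rewrite big_nat_recr /=; last by lia.
  rewrite big_nat_recr /=; last by lia.
  rewrite !subSS !subn0 subSnn (_ : n.+2 - n = 2)%N; last by lia.
  ring.
set N := \sum_(3 <= j < _) _ in EM.
move=> dR; set f := (X in deg_le _ X).
have -> : f = Rser r n - 2%:R^-1 * M + 2%:R^-1 * N.
  by rewrite /f EM; field.
apply: deg_leD dR (deg_leZ _ _ _ (proper_frac_natV 2) _).
rewrite /N big_seq; apply: deg_le_sum => j; rewrite mem_index_iota => /andP[j3 jn].
apply: deg_le_leq (deg_leM _ _ _ _ (deg_le_Pser _) (deg_le_Pser _)).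
(* Convexity gives d_j + d_(n-j) <= d_3 + d_(n-3), and d_3 <= 2r + (d_4 - d_3) <= 2r + (d_(n-2) -
   d_(n-3)), because the range of j forces n >= 6. *)
have := @pdeg_convex r hr (j - 3)%N 3 (n - j)%N.
rewrite (subnKC j3) (_ : n - j + (j - 3) = n - 3)%N; last by lia.
have := pdeg3 r hr; have := @pinc_mono r 3%N (n - 3)%N.
have := pdegS r (n - 3)%N r_gt0; rewrite (_ : (n - 3).+1 = n - 2)%N; last by lia.
move=> E1 E2 E3 E4; have {}E2 := E2 ltac:(lia); have {}E4 := E4 ltac:(lia).
lia.
Qed.
End Bounds.

(** * Auxiliary facts on q and field identities *)

Lemma proper_frac_1subqXV : proper_frac (1 - qX ^ (- 1)).
Proof.
by apply: proper_fracD (proper_frac_nat 1) (proper_fracN _ _); rewrite exprN1 -[qX]expr1; exact: proper_frac_qXV.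
Qed.

Lemma qX_expr_neq1 m : (0 < m)%N -> qX ^+ m - 1 != 0.
Proof.
move=> m0; rewrite subr_eq0 /qX -tofracXn -tofrac1 tofrac_eq.
apply/eqP => /(congr1 (fun p : {poly rat} => size p)).
by rewrite size_polyXn size_poly1 => -[m_eq0]; rewrite m_eq0 in m0.
Qed.

Lemma qX_geoE : (1 - qX ^ (- 1))^-1 = qX / (qX - 1).
Proof.
have q1 := qX_expr_neq1 1 isT; rewrite expr1 in q1.
rewrite exprN1 -[X in X - _](divff qX_neq0) -[X in _ - X]mul1r -mulrBl.
exact: invf_div.
Qed.

(* Stated over an abstract field: over Q(q) itself, unification unfolds the
   fraction field and the side conditions of field are intractable. *)
Section Identities.
Variable K : fieldType.
Implicit Types a b c d e g q u v : K.

Lemma rho_identity a d v : a != 0 ->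
  d * a * ((1 - a^-1) * v) = v * (a - 1) * d.
Proof. by move=> a0; field. Qed.

Lemma Rser2_identity a q : (2%:R : K) != 0 -> a != 0 -> q != 0 -> q - 1 != 0 ->
  q / (q - 1) * (a - 1) * (q / (q - 1) * (a - 1) + 1) / 2%:R =
  (q / (q - 1)) ^+ 2 * (a - 1) * a / 2%:R * (1 - a^-1 * q^-1).
Proof. by move=> n2 a0 q0 q1; field; rewrite n2 a0 q0 q1. Qed.

(** Here a, b, c are P_1, P_2, P_3. The last two summands in the bracket are the terms k = 2, which
    vanishes, and k = 3, which contributes -P_1/3 to I. *)
Lemma Rser3_log_identity a b c : (2%:R : K) != 0 -> (3%:R : K) != 0 ->
  c - (c - a * b + a ^+ 3 / 3%:R
       + (((-1) ^+ 1)%:~R / 2%:R * (0 - 0 * a + 0 ^+ 3 / 3%:R)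
          + ((-1) ^+ 1)%:~R / 3%:R * (a - 0 * 0 + 0 ^+ 3 / 3%:R))) =
  a * b - (a ^+ 3 - a) / 3%:R.
Proof. by move=> n2 n3; field; rewrite n2 n3. Qed.

(** Here a = q^r and b = q^(r(r-1)/2), so that b a = q^(r(r+1)/2) and b a a = q^(d_2). *)
Lemma Rser3_identity a b q : (3%:R : K) != 0 -> a != 0 -> b != 0 -> q != 0 ->
    q - 1 != 0 ->
  q / (q - 1) * (a - 1) * (q / (q - 1) * (b * a * a - a))
    - ((q / (q - 1) * (a - 1)) ^+ 3 - q / (q - 1) * (a - 1)) / 3%:R =
  (q / (q - 1)) ^+ 2 * (a - 1) * (b * a * a)
  * (1 - (b * a)^-1
       - b^-1 * ((1 - 2%:R * a^-1 + 2%:R * ((a * a)^-1 * q^-1)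
                    - (a * a)^-1 * (q ^+ 2)^-1)
                 / (3%:R * (q / (q - 1))^-1))).
Proof. by move=> n3 a0 b0 q0 q1; field; rewrite n3 a0 b0 q0 q1. Qed.

(** Here u = 1/(1 - q^-1), a = q^r, b = q^(d_2), and d, e, g are the powers of q with exponents
    d_(n-1), d_(n-2), d_(n-3). The last bracket collects the non-leading parts of P_1 P_(n-1) and c
    P_2 P_(n-2). *)
Lemma error_identity a b c d e g R u :
  R - u ^+ 2 * (a - 1) * d - c * u ^+ 2 * (b * e) =
    R - (u * (a - 1) * (u * (d - e)) + c * (u * (b - a) * (u * (e - g))))
    + (u ^+ 2 * (e - a * e) + c * u ^+ 2 * (a * g - a * e - b * g)).
Proof. ring. Qed.

(** Now u = 1 - q^-1, a = q^r, b = q^(r(r-1)/2), e = q^(d_(n-2)), d = q^(d_(n-1) - d_(n-2)), and g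
    is the proper factor of the error. *)
Lemma asymp_identity a b c d e g u : u != 0 -> c != 0 -> a != 0 -> a - 1 != 0 ->
    b != 0 -> d != 0 ->
  a * a * e * g + u^-1 ^+ 2 * (a - 1) * (e * d) + c * u^-1 ^+ 2 * (b * a * a * e) =
  u^-1 ^+ 2 * (a - 1) * (e * d)
  * (1 + d^-1 * (b * a) * (c * ((1 + c^-1 * u ^+ 2 * g / b) / (1 - a^-1)))).
Proof. by move=> u0 c0 a0 a1 b0 d0; field; rewrite u0 c0 a0 a1 b0 d0. Qed.
End Identities.

(** * Exact values for n <= 3 and the asymptotic form for n >= 4 *)

Section Coefficients.
Variables (r : nat) (hr : (2 <= r)%N).

Let r_gt0 : (0 < r)%N. Proof. exact: ltnW. Qed.

(** In this form rho_(r,n+1) is P_1 P_n with P_n replaced by its leading part q^(d_n)/(1 - q^-1). *)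
Lemma rhoE n : rho r n.+1 =
  (1 - qX ^ (- 1))^-1 ^+ 2 * (qX ^+ r - 1) * qX ^+ pdeg r n.
Proof.
rewrite /rho (_ : 'C(r + n.+1 - 1, r) + r - 1 = pdeg r n + r)%N.
  by rewrite exprD -exprnN exprVn; exact: rho_identity (qX_expr_neq0 _).
rewrite /pdeg (_ : r + n.+1 - 1 = r + n)%N; last by lia.
have : (0 < 'C(r + n, r))%N by rewrite bin_gt0 leq_addr.
lia.
Qed.

Lemma Pser1 : Pser r 1%N = (1 - qX ^ (- 1))^-1 * (qX ^+ r - 1).
Proof. by rewrite PserS // pdeg1 // pdeg0. Qed.

Lemma Rser0 : Rser r 0%N = 1.
Proof. by rewrite /Rser /fps_sub Pser0 /Iser /fps_sum big_geq // subr0. Qed.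

Lemma Iser_term1 n : Iser_term r 1 n = fps_log (fps_subst_pow (Pser r) 1) n.
Proof. by rewrite /Iser_term /fps_scale /moebius /= divr1 mul1r. Qed.

Lemma Pser_subst0 k : fps_subst_pow (Pser r) k 0%N = 1.
Proof. by rewrite /fps_subst_pow dvdn0 div0n Pser0. Qed.

Lemma Rser1 : Rser r 1%N = 0.
Proof.
rewrite /Rser /fps_sub /Iser /fps_sum big_nat1 Iser_term1.
by rewrite fps_log1 ?Pser_subst0 // fps_subst_pow1 subrr.
Qed.

(** The term k = 1 leaves P_1^2/2, and k = 2 contributes P_1/2 because the Moebius value at 2 is
    -1. *)
Lemma Rser2 : Rser r 2%N = Pser r 1%N * (Pser r 1%N + 1) / 2%:R.
Proof.
rewrite /Rser /fps_sub /Iser /fps_sum big_ltn // big_nat1 Iser_term1.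
rewrite /Iser_term /fps_scale !fps_log2 ?Pser_subst0 // !fps_subst_pow1.
rewrite /moebius /fps_subst_pow /= divnn /=.
have n2 := natq_neq0 1; move: (Pser r 1) (Pser r 2) => a b.
by field.
Qed.

Lemma Rser3 : Rser r 3%N =
  Pser r 1%N * Pser r 2%N - (Pser r 1%N ^+ 3 - Pser r 1%N) / 3%:R.
Proof.
have n2 := natq_neq0 1; have n3 := natq_neq0 2.
rewrite /Rser /fps_sub /Iser /fps_sum big_ltn // big_ltn // big_nat1 Iser_term1.
rewrite /Iser_term /fps_scale !(fps_log3 _ _ n2 n3 (Pser_subst0 _)) !fps_subst_pow1.
rewrite /moebius /fps_subst_pow /= !divnn /=.
exact (Rser3_log_identity Qq (Pser r 1) (Pser r 2) (Pser r 3) n2 n3).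
Qed.

(** The constant c covers both cases at once: 1/2 for n = 4 and 1 for n >= 5. Its inverse enters the
    relative error f. *)
Lemma Rser_asymp n (c : Qq) : (4 <= n)%N -> c != 0 -> proper_frac c -> proper_frac c^-1 ->
    deg_le (2 * r + pdeg r (n - 2))
      (Rser r n - (Pser r 1 * Pser r (n - 1)%N + c * (Pser r 2 * Pser r (n - 2)%N))) ->
  exists f, isO_q (r * (r - 1) %/ 2) f /\
    Rser r n = rho r n * (1 + qX ^ (- ('C(r + n - 2, r - 1))%N%:Z
                                     + (r * (r + 1) %/ 2)%N%:Z)
                              * (c * ((1 + f) / (1 - qX ^ (- r%:Z))))).
Proof.
case: n => [|[|[|n]]] // n4 c0 pc pcV; rewrite !subSS !subn0 => dE.
have u0 := qX_neq1; have q0 := qX_neq0.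
set u := 1 - qX ^ (- 1) in u0 *.
have pu : proper_frac u^-1 := proper_frac_geo.
(* The error left after removing rho and the leading part of c P_2 P_(n-2), with the index shifted
   by 3. *)
set E := Rser r n.+3 - rho r n.+3 - c * u^-1 ^+ 2 * (qX ^+ pdeg r 2 * qX ^+ pdeg r n.+1).
have [g pg Eg] : deg_le (2 * r + pdeg r n.+1) E.
  have -> : E = Rser r n.+3 - (Pser r 1 * Pser r n.+2 + c * (Pser r 2 * Pser r n.+1))
      + (u^-1 ^+ 2 * (qX ^+ pdeg r n.+1 - qX ^+ pdeg r 1 * qX ^+ pdeg r n.+1)
       + c * u^-1 ^+ 2 * (qX ^+ pdeg r 1 * qX ^+ pdeg r n - qX ^+ pdeg r 1 * qX ^+ pdeg r n.+1
            - qX ^+ pdeg r 2 * qX ^+ pdeg r n)).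
    by rewrite /E !PserS // rhoE pdeg1 // pdeg0 expr0 -/u; exact: error_identity.
  have p2 : proper_frac (u^-1 ^+ 2) by exact: proper_fracM.
  have dQ a b : (pdeg r a + pdeg r b <= 2 * r + pdeg r n.+1)%N ->
      deg_le (2 * r + pdeg r n.+1) (qX ^+ pdeg r a * qX ^+ pdeg r b).
    by move=> le; apply: deg_le_leq (deg_leM _ _ _ _ (deg_le_qX _) (deg_le_qX _)).
  have le1 : (pdeg r n <= pdeg r n.+1)%N by apply: pdeg_mono.
  have le2 : (pdeg r 2 + pdeg r n <= r + pdeg r n.+1)%N.
    (* After the shift [n4] reduces to 1 <= n, the condition for convexity. *)
    by have := @pdeg_convex r hr 1 1 n; rewrite pdeg1 // !addn1 => /(_ n4).
  have d11 : deg_le (2 * r + pdeg r n.+1) (qX ^+ pdeg r 1 * qX ^+ pdeg r n.+1).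
    by apply: dQ; rewrite pdeg1 //; lia.
  apply: deg_leD dE (deg_leD _ _ _ _ _); apply: deg_leZ.
  - exact: p2.
  - apply: deg_leD (deg_leN _ _ d11).
    by apply: deg_le_leq (deg_le_qX _); rewrite leq_addl.
  - exact: proper_fracM.
  - apply: deg_leD (deg_leN _ _ _); last by apply: dQ; lia.
    by apply: deg_leD (deg_leN _ _ d11); apply: dQ; rewrite pdeg1 //; lia.
(* This is the error q^(2r + d_(n-2)) g, with n the unshifted index, divided by c u^-2 q^(d_2 +
   d_(n-2)). *)
exists (c^-1 * u ^+ 2 * g / qX ^+ (r * (r - 1) %/ 2)); split.
  apply: isO_q_proper; apply: proper_fracM pg; apply: proper_fracM pcV _.
  by apply: proper_fracM; exact: proper_frac_1subqXV.
have -> : Rser r n.+3 = E + rho r n.+3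
     + c * u^-1 ^+ 2 * (qX ^+ pdeg r 2 * qX ^+ pdeg r n.+1) by rewrite /E; ring.
have X0 := qX_expr_neq0.
have e1 : qX ^+ (2 * r + pdeg r n.+1) = qX ^+ r * qX ^+ r * qX ^+ pdeg r n.+1.
  by rewrite mulSn mul1n !exprD.
have e2 : qX ^+ pdeg r n.+2 = qX ^+ pdeg r n.+1 * qX ^+ pinc r n.+1.
  by rewrite pdegS // exprD.
have e3 : qX ^+ pdeg r 2 = qX ^+ (r * (r - 1) %/ 2) * qX ^+ r * qX ^+ r.
  by rewrite pdeg2 // triangle_step // !exprD.
have e4 : qX ^ (- ('C(r + n.+3 - 2, r - 1))%N%:Z + (r * (r + 1) %/ 2)%N%:Z)
    = (qX ^+ pinc r n.+1)^-1 * (qX ^+ (r * (r - 1) %/ 2) * qX ^+ r).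
  rewrite (_ : r + n.+3 - 2 = r + n.+1)%N; last by lia.
  by rewrite (expfzDr _ _ qX_neq0) -exprnN triangle_step // -exprD.
rewrite Eg rhoE -/u e1 e2 e3 e4 -exprnN.
exact (asymp_identity _ _ _ _ _ _ _ _ u0 c0 (X0 _) (qX_expr_neq1 _ r_gt0) (X0 _) (X0 _)).
Qed.
End Coefficients.

Theorem theorem3p3 (r : nat) (hr : (2 <= r)%N) :
  Rser r 0%N = 1 /\
  Rser r 1%N = 0 /\
  Rser r 2%N = rho r 2 / 2%:R * (1 - qX ^ (- r%:Z - 1)) /\
  Rser r 3%N = rho r 3 *
    (1 - qX ^ (- (r * (r + 1) %/ 2)%N%:Z)
       - qX ^ (- (r * (r - 1) %/ 2)%N%:Z) *
         ((1 - 2%:R * qX ^ (- r%:Z) + 2%:R * qX ^ (- (2 * r)%N%:Z - 1)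
             - qX ^ (- (2 * r)%N%:Z - 2))
          / (3%:R * (1 - qX ^ (- 1))))) /\
  (exists f : Qq, isO_q (r * (r - 1) %/ 2)%N f /\
     Rser r 4%N = rho r 4 *
       (1 + qX ^ (- ('C(r + 1, 3))%N%:Z) *
            ((1 + f) / (2%:R * (1 - qX ^ (- r%:Z)))))) /\
  (forall n : nat, (5 <= n)%N ->
     exists f : Qq, isO_q (r * (r - 1) %/ 2)%N f /\
       Rser r n = rho r n *
         (1 + qX ^ (- ('C(r + n - 2, r - 1))%N%:Z + (r * (r + 1) %/ 2)%N%:Z) *
              ((1 + f) / (1 - qX ^ (- r%:Z))))).
Proof.
have r_gt0 : (0 < r)%N := ltnW hr.
have q0 := qX_neq0; have q1 := qX_expr_neq1 1 isT; rewrite expr1 in q1.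
have X0 := qX_expr_neq0.
have n2 := natq_neq0 1; have n3 := natq_neq0 2.
split; first exact: Rser0.
split; first exact: Rser1.
split.
  rewrite Rser2 (Pser1 r hr) (rhoE r hr) (pdeg1 r hr) qX_geoE (expfzDr _ _ q0) -exprnN exprN1.
  exact (Rser2_identity _ _ _ n2 (X0 _) q0 q1).
split.
  rewrite Rser3 (Pser1 r hr) (PserS r hr) (rhoE r hr) (pdeg2 r hr) (pdeg1 r hr).
  have geoE : 1 - qX ^ (- 1) = (qX / (qX - 1))^-1 by rewrite -qX_geoE invrK.
  rewrite (triangle_step r hr) geoE invrK !(expfzDr _ _ q0) exprN1 -!exprnN.
  rewrite mulSn mul1n !exprD.
  exact (Rser3_identity _ _ _ _ n3 (X0 _) (X0 _) q0 q1).
split.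
  have pV : proper_frac (2%:R^-1)^-1 by rewrite invrK; exact: proper_frac_nat.
  have dR := deg_le_Rser_main r hr 4 isT.
  have [f [Of ->]] :=
    Rser_asymp r hr 4 2%:R^-1 isT (invr_neq0 n2) (proper_frac_natV 2) pV dR.
  exists f; split; first exact: Of.
  congr (_ * (1 + qX ^ _ * _)).
    rewrite (_ : r + 4 - 2 = r + 2)%N; last by lia.
    rewrite -/(pinc r 2) pinc2 //; lia.
  by rewrite invfM mulrCA.
move=> n n5; have pV : proper_frac 1^-1 by rewrite invr1; exact: (proper_frac_nat 1).
have dR := deg_le_Rser_main r hr n (ltnW n5); rewrite gtn_eqF // in dR.
have [f [Of ->]] :=
  Rser_asymp r hr n 1 (ltnW n5) (oner_neq0 _) (proper_frac_nat 1) pV dR.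
by exists f; split; [exact: Of | rewrite mul1r].
Qed.
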